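(* Let $\sum_{n=1}^\infty a_n$ be a series of strictly positive real numbers. Then $\inf\{a_n : n\in\mathbb{N}\}>0$ if and only if the topological space $\mathbb{N}_{a_n}$ is compact.
   Context: $\mathbb{N}=\{1,2,3,\dots\}$. For a series $\sum_{n=1}^\infty a_n$ of strictly positive real numbers and $A\subseteq\mathbb{N}$, write $\sum_A a_n=\sum_{n\in A}a_n\in[0,\infty]$. $\mathbb{N}_{a_n}$ denotes the set $\mathbb{N}$ with the topology whose closed sets are exactly $\mathbb{N}$ itself and all $A\subseteq\mathbb{N}$ with $\sum_A a_n<\infty$. Compact means every open cover has a finite subcover (no Hausdorff condition). *)

(* Defs.v *)
From HB Require Import structures.
From mathcomp Require Import all_boot all_order all_algebra.
From mathcomp Require Import all_classical all_reals all_analysis.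

Set Implicit Arguments.
Unset Strict Implicit.
Unset Printing Implicit Defensive.

Import Order.TTheory GRing.Theory Num.Theory.

Local Open Scope classical_set_scope.
Local Open Scope ring_scope.

(* The natural numbers start at 1. *)
Definition posnat : Type := {n : nat | (0 < n)%N}.
HB.instance Definition _ := Countable.on posnat.

Section SeriesSpace.
Variables (R : realType) (a : posnat -> R).

Definition series_closed (A : set posnat) : Prop :=
  A = setT \/ (\esum_(n in A) (a n)%:E < +oo)%E.

Lemma series_closed0 : series_closed set0.
Proof. by right; rewrite esum_set0 ltry. Qed.

Lemma series_closed_sub (A B : set posnat) : A `<=` B ->
  (\esum_(n in B) (a n)%:E < +oo)%E -> (\esum_(n in A) (a n)%:E < +oo)%E.
Proof.
move=> AB; apply: le_lt_trans; apply: ereal_sup_le => _ [F [finF FA] <-].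
by exists F => //; split=> // x /FA /AB.
Qed.

Lemma series_closed_bigcap (I : Type) (F : I -> set posnat) :
  (forall i, series_closed (F i)) -> series_closed (\bigcap_i F i).
Proof.
move=> clF; have [FT|/existsNP [i FiT]] := pselect (forall i, F i = setT).
  by left; rewrite -subTset => x _ i _; rewrite FT.
right; have [//|] := clF i; apply: series_closed_sub.
exact: bigcap_inf.
Qed.

Hypothesis a_gt0 : forall n, 0 < a n.

Lemma series_closedU (A B : set posnat) :
  series_closed A -> series_closed B -> series_closed (A `|` B).
Proof.
move=> [->|fA]; first by left; rewrite setTU.
move=> [->|fB]; first by left; rewrite setUT.
right; rewrite (esumID A) => [|n _]; last by rewrite lee_fin ltW.
by apply: lte_add_pinfty; [apply: series_closed_sub fA | apply: series_closed_sub fB];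
  move=> x [] // [].
Qed.

End SeriesSpace.

(* An alias of the positive integers carrying the topology of the series;
   positivity of the terms is what makes the closed sets stable under finite
   unions, so its proof is a parameter of the alias. *)
Definition series_space (R : realType) (a : posnat -> R)
  (a_gt0 : forall n, 0 < a n) : Type := posnat.

Section SeriesTopology.
Variables (R : realType) (a : posnat -> R) (a_gt0 : forall n, 0 < a n).

HB.instance Definition _ := Choice.copy (series_space a_gt0) posnat.

Let op : set_system (series_space a_gt0) := [set U | series_closed a (~` U)].

Let opT : op setT.
Proof. by rewrite /op /= setCT; exact: series_closed0. Qed.

Let opI : setI_closed op.
Proof. by move=> U V; rewrite /op /= setCI; exact: series_closedU. Qed.

Let op_bigU (I : Type) (f : I -> set (series_space a_gt0)) :
  (forall i, op (f i)) -> op (\bigcup_i f i).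
Proof. by move=> opf; rewrite /op /= setC_bigcup; exact: series_closed_bigcap. Qed.

HB.instance Definition _ :=
  isOpenTopological.Build (series_space a_gt0) opT opI op_bigU.

Lemma open_series_spaceE (U : set (series_space a_gt0)) :
  open U <-> series_closed a (~` U).
Proof. by []. Qed.

Lemma closed_series_spaceE (A : set (series_space a_gt0)) :
  closed A <-> A = setT \/ (\esum_(n in A) (a n)%:E < +oo)%E.
Proof. by rewrite -openC open_series_spaceE setCK. Qed.

End SeriesTopology.

(* Main.v *)
(* If the terms are at least [d > 0], sets of finite sum are finite, so every
   nonempty open set is cofinite and the space is compact.  Otherwise choosing
   terms below [2^-(k+1)] yields an infinite [A] of finite sum; [A] is then
   closed and discrete, and the open sets [~` (A `\ x)] for [x] in [A] cover
   the space without a finite subcover. *)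

Require Import Defs.
From mathcomp Require Import all_boot all_order all_algebra.
From mathcomp Require Import finmap.
From mathcomp Require Import all_classical all_reals all_analysis.

Import Order.TTheory GRing.Theory Num.Theory.

Local Open Scope classical_set_scope.
Local Open Scope ring_scope.

(** More than [r / d] points of [A] already contribute at least [r], for every [r]. *)
Lemma esum_pinfty_infinite_set (R : realType) (T : choiceType) (a : T -> R)
    (d : R) (A : set T) : 0 < d -> (forall x, A x -> d <= a x) ->
  infinite_set A -> (\esum_(x in A) (a x)%:E = +oo)%E.
Proof.
move=> d0 da Ainf; apply/eqyP => r r0.
pose n := (Num.truncn (r / d)).+1.
have [B BA nB] := infinite_set_fset n Ainf.
apply: esum_ge; exists [set` B]; first by split.
rewrite fsbig_finite//= set_fsetK sumEFin lee_fin.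
apply: (@le_trans _ _ (\sum_(x <- B) d)); last first.
  by rewrite big_seq [leRHS]big_seq; apply: ler_sum => x xB; exact/da/BA.
rewrite big_const_seq count_predT iter_addr_0 -mulr_natr mulrC.
rewrite -ler_pdivrMr//; apply: (@le_trans _ _ n%:R); last by rewrite ler_nat.
by rewrite ltW// truncnS_gt.
Qed.

Lemma infinite_set_esum_lty (R : realType) (T : choiceType) (a : T -> R) :
  (forall x, 0 < a x) -> (forall e, 0 < e -> exists x, a x < e) ->
  exists2 A : set T, infinite_set A & (\esum_(x in A) (a x)%:E < +oo)%E.
Proof.
move=> a0 a_small.
pose b (k : nat) : R := 1 / (2 ^ k.+1)%:R.
have b0 k : 0 < b k by rewrite divr_gt0// ltr0n expn_gt0.
have /choice[s sb] k : exists x, a x < b k by exact: a_small.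
exists (range s).
  move=> /finite_fsetP[X sX].
  (* The default 1 keeps [d] positive even for empty [X]. *)
  pose d := \big[Num.min/1]_(x <- X) a x.
  have d0 : 0 < d by rewrite /d; apply: lt_bigmin.
  (* Then [d^-1 < k + 1 < 2 ^ (k + 1)], so [b k < d] and [a (s k)] undercuts the minimum. *)
  pose k := Num.truncn d^-1.
  have : a (s k) < d.
    apply: lt_trans (sb k) _; rewrite /b div1r invf_plt ?posrE ?ltr0n ?expn_gt0//.
    apply: (lt_trans (truncnS_gt _)); rewrite ltr_nat -/k.
    exact: ltn_expl.
  apply/negP; rewrite -leNgt; apply: ge_bigmin_seq => //.
  by have : [set` X] (s k) by rewrite -sX; exists k.
(* [s] may repeat values; [g] picks one index per value, so the sum over the range is bounded by the
   sum of all [b k], which is at most 1. *)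
have /choice[g gK] x : exists k, range s x -> s k = x.
  have [[k _ <-]|] := pselect (range s x); first by exists k.
  by exists 0%N.
have ginj : set_inj (range s) g.
  by move=> x y; rewrite !inE => /gK + /gK + gxy => <- <-; rewrite gxy.
apply: (@le_lt_trans _ _ (\esum_(x in range s) (b (g x))%:E)%E).
  by apply: le_esum => x /gK sgx; rewrite lee_fin -{1}sgx ltW.
rewrite -(esum_image _ _ (fun k => (b k)%:E))//.
apply: (@le_lt_trans _ _ (\esum_(k in [set: nat]) (b k)%:E)%E).
  by apply: ereal_sup_le => _ [F [finF _] <-]; exists F.
rewrite -nneseries_esumT => [|k]; last by rewrite lee_fin ltW.
exact: le_lt_trans (epsilon_trick0 xpredT ler01) (ltry _).
Qed.

(** One nonempty member of the cover leaves finitely many points, each needing one further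
    member. *)
Lemma cover_compact_cofinite (T : topologicalType) :
  (forall U : set T, open U -> U !=set0 -> finite_set (~` U)) ->
  cover_compact [set: T].
Proof.
move=> cofin I D f fop fcov.
have [T0|/set0P[x0 _]] := eqVneq [set: T] set0.
  by exists fset0 => [i|x Tx]; [rewrite inE|move: Tx; rewrite T0].
have [i0 Di0 fx0] := fcov x0 Logic.I.
have /finite_fsetP[X Xf] := cofin _ (fop _ Di0) (ex_intro _ x0 fx0).
have /choice[h hP] x : exists i, D i /\ f i x.
  by have [i Di fi] := fcov x Logic.I; exists i.
exists (i0 |` h @` X)%fset.
  by move=> i /fset1UP[->|/imfsetP[x _ ->]]; rewrite inE//; exact: (hP x).1.
move=> x _; have [fx|fx] := pselect (f i0 x).
  by exists i0 => //=; rewrite !inE eqxx.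
have xX : x \in X by have : [set` X] x by rewrite -Xf.
exists (h x); last exact: (hP x).2.
by rewrite /= in_fset1U in_imfset// orbT.
Qed.

Theorem theorem1p2 (R : realType) (a : posnat -> R)
    (a_gt0 : forall n : posnat, 0 < a n) :
  0 < inf (range a) <-> cover_compact [set: series_space a_gt0].
Proof.
split=> [inf_gt0|].
  apply: cover_compact_cofinite => U /open_series_spaceE [UT|fU] [x Ux].
    by have : (~` U) x by rewrite UT.
  apply: contrapT => Uinf; move: fU.
  rewrite (esum_pinfty_infinite_set _ _ a (inf (range a)))// => n _.
  apply: ge_inf; last by exists n.
  (* The bound 0 makes [inf] a genuine lower bound of the terms. *)
  by exists 0 => _ [m _ <-]; exact: ltW.
move=> cpt; rewrite ltNge; apply/negP => inf_le0.
have [e e0|A Ainf Afin] := infinite_set_esum_lty _ _ a a_gt0.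
  have [||_ [n _ <-] an] := @inf_lt _ (range a) e; last by exists n.
  - by exists (a (exist _ 1%N isT)), (exist _ 1%N isT).
  - exact: le_lt_trans e0.
pose f (x : series_space a_gt0) : set (series_space a_gt0) := ~` (A `\ x).
have [x _||X _ Xcov] := cpt _ A f.
- apply/open_series_spaceE; right; rewrite setCK.
  by apply: series_closed_sub Afin => y [].
- move=> x _; have [Ax|nAx] := pselect (A x).
    by exists x => // -[_]; apply.
  (* A point outside [A] lies in every [f y], so any index in [A] serves. *)
  have [y Ay] := infinite_setN0 Ainf.
  by exists y => // -[/nAx].
- apply: Ainf; apply: sub_finite_set (finite_fset X) => x Ax.
  (* Within [A], [f y] contains only [y]; hence [x = y] and [A] lies in the finite [X]. *)
  have [y yX fyx] := Xcov x Logic.I.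
  by have [->//|xy] := eqVneq x y; case: fyx; split=> //; exact/eqP.
Qed.
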